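(* Let $X$ be a finite digital image and $Y$ a digital image. Two continuous maps $f,g:X\to Y$ are strongly homotopic if and only if they are homotopic by a punctuated homotopy.
   Context: A digital image is a set $X$ together with a symmetric, antireflexive adjacency relation (equivalently, a simple graph). Write $x\leftrightarrow x'$ for ''adjacent'' and $x\mathrel{\underline{\leftrightarrow}} x'$ for ''adjacent or equal''. A function $f:X\to Y$ between digital images is continuous if $x\leftrightarrow x'$ implies $f(x)\mathrel{\underline{\leftrightarrow}} f(x')$. For integers $a\le b$, $[a,b]_{\mathbb Z}=\{a,a+1,\dots,b\}$, with adjacency $c_1$: $s,t$ are adjacent iff $|s-t|=1$. Homotopy: for continuous $f,g:X\to Y$, a homotopy from $f$ to $g$ is a function $H:X\times[0,k]_{\mathbb Z}\to Y$, for some positive integer $k$, with $H(x,0)=f(x)$ and $H(x,k)=g(x)$ for all $x$, such that $t\mapsto H(x,t)$ is continuous for each fixed $x\in X$ and $x\mapsto H(x,t)$ is continuous for each fixed $t\in[0,k]_{\mathbb Z}$. Strong homotopy: the $\mathrm{NP}_2$ adjacency on $X\times[0,k]_{\mathbb Z}$ makes two distinct points $(x,t),(x',t')$ adjacent iff $x\mathrel{\underline{\leftrightarrow}} x'$ and $t\mathrel{\underline{\leftrightarrow}} t'$. A strong homotopy from $f$ to $g$ is a function $H:X\times[0,k]_{\mathbb Z}\to Y$ with $H(x,0)=f(x)$, $H(x,k)=g(x)$ for all $x$, which is continuous with respect to the $\mathrm{NP}_2$ adjacency on the domain. If one exists, $f$ and $g$ are strongly homotopic. A homotopy $H:X\times[0,k]_{\mathbb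 Z}\to Y$ is punctuated if for each $t$ with $0\le t<k$ there is some $x_t$ such that $H(x,t)=H(x,t+1)$ for all $x\neq x_t$; that is, from each stage to the next the map changes by one point at a time.
   Formalization: The digital image X is additionally assumed nonempty: for empty X the unique map is strongly homotopic to itself, but no punctuated homotopy exists, since the definition asks for a point x_t of X at each stage. *)

(* Defs.v *)
From mathcomp Require Import all_boot all_order all_algebra.
From mathcomp Require Import boolp classical_sets cardinality.

Set Implicit Arguments.
Unset Strict Implicit.
Unset Printing Implicit Defensive.

Record digital_image := DigitalImage {
  di_sort :> Type;
  adj : di_sort -> di_sort -> Prop;
  adj_sym : forall x y, adj x y -> adj y x;
  adj_irrefl : forall x, ~ adj x x }.

Definition adjeq (X : digital_image) (x y : X) : Prop := adj x y \/ x = y.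

Lemma adjeq_sym (X : digital_image) (x y : X) : adjeq x y -> adjeq y x.
Proof. by case=> [/adj_sym|->]; [left|right]. Qed.

Definition digitally_continuous (X Y : digital_image) (f : X -> Y) : Prop :=
  forall x x' : X, adj x x' -> adjeq (f x) (f x').

(* The points of [0,k]_Z are the ordinals below k + 1; the distance
   `|s - t| is taken in int, not with truncated subtraction. *)
Definition c1_adj (k : nat) (s t : 'I_k.+1) : Prop :=
  (`|(s : nat)%:Z - (t : nat)%:Z| = 1)%R.

Lemma c1_adj_sym k (s t : 'I_k.+1) : c1_adj s t -> c1_adj t s.
Proof. by rewrite /c1_adj Num.Theory.distrC. Qed.

Lemma c1_adj_irrefl k (s : 'I_k.+1) : ~ c1_adj s s.
Proof. by rewrite /c1_adj GRing.subrr Num.Theory.normr0. Qed.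

Definition interval0 (k : nat) : digital_image :=
  DigitalImage (@c1_adj_sym k) (@c1_adj_irrefl k).

Section NP2.
Variables X Y : digital_image.

Definition np2_adj (p q : X * Y) : Prop :=
  [/\ p <> q, adjeq p.1 q.1 & adjeq p.2 q.2].

Lemma np2_adj_sym p q : np2_adj p q -> np2_adj q p.
Proof. by case=> npq /adjeq_sym ? /adjeq_sym ?; split=> // /esym. Qed.

Lemma np2_adj_irrefl p : ~ np2_adj p p.
Proof. by case. Qed.

Definition np2_product : digital_image :=
  DigitalImage np2_adj_sym np2_adj_irrefl.

End NP2.

Section Homotopy.
Variables X Y : digital_image.

Definition homotopy (f g : X -> Y) (k : nat)
    (H : X * interval0 k -> Y) : Prop :=
  [/\ forall x, H (x, ord0) = f x,
      forall x, H (x, ord_max) = g x,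
      forall x, digitally_continuous (fun t : interval0 k => H (x, t)) &
      forall t, digitally_continuous (fun x : X => H (x, t))].

Definition strong_homotopy (f g : X -> Y) (k : nat)
    (H : np2_product X (interval0 k) -> Y) : Prop :=
  [/\ forall x, H (x, ord0) = f x,
      forall x, H (x, ord_max) = g x &
      digitally_continuous H].

Definition strongly_homotopic (f g : X -> Y) : Prop :=
  exists2 k : nat, 0 < k &
    exists H : np2_product X (interval0 k) -> Y, strong_homotopy f g H.

(* For t : 'I_k, the stages t and t + 1 of [0,k]_Z are
   widen_ord (leqnSn k) t and lift ord0 t.  Since some xt must exist at each
   stage, no H with k > 0 is punctuated when X is empty. *)
Definition punctuated (k : nat) (H : X * interval0 k -> Y) : Prop :=
  forall t : 'I_k, exists xt : X, forall x : X, x <> xt ->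
    H (x, widen_ord (leqnSn k) t) = H (x, lift ord0 t).

Definition punctuated_homotopic (f g : X -> Y) : Prop :=
  exists2 k : nat, 0 < k &
    exists H : X * interval0 k -> Y, homotopy f g H /\ punctuated H.

End Homotopy.

(* Main.v *)
(** A punctuated step is automatically strong: if [H t] and [H t.+1] agree off
    one point, then for distinct adjacent [x], [x'] at least one of them is
    unaffected by the step, so [H t x] and [H t.+1 x'] are compared inside a
    single stage.

    Conversely, let [e] be an injection of [X] into the integers below
    [n], and slow a strong homotopy [H] down [n] times with an [x]-dependent
    delay: [(x, t) |-> H (x, (t + e x) %/ n)].  Delays of different points
    differ by less than [n], so [NP_2]-continuity of [H] keeps every stage
    continuous, and a point moves between [t] and [t.+1] only if [n] divides
    [t.+1 + e x], which happens for at most one [x]. *)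
Require Import Defs.
From mathcomp Require Import all_boot all_order all_algebra.
From mathcomp Require Import boolp classical_sets cardinality.
From mathcomp Require Import zify.

Set Implicit Arguments.
Unset Strict Implicit.
Unset Printing Implicit Defensive.

Local Open Scope classical_set_scope.

Lemma finite_type_bounded_injection (T : Type) :
  finite_set [set: T] ->
  exists n (e : T -> nat), (forall x, e x < n) /\ injective e.
Proof.
case=> n /card_set_bijP[e [eb einj _]]; exists n, e; split=> [x|x y exy].
  exact: eb.
by apply: einj => //; rewrite inE.
Qed.

Lemma digitally_continuous_adjeq (X Y : digital_image) (f : X -> Y) :
  digitally_continuous f -> forall x x', adjeq x x' -> adjeq (f x) (f x').
Proof. by move=> fcont x x' [/fcont|->] //; right. Qed.

Lemma adjeq_intervalP k (s t : interval0 k) :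
  adjeq s t <-> (s : nat) <= (t : nat).+1 /\ (t : nat) <= (s : nat).+1.
Proof.
split=> [[|->]|[st ts]]; rewrite /adj /= /c1_adj; try lia.
have [|nst] := eqVneq (s : nat) (t : nat); first by move/val_inj; right.
by left; rewrite /adj /= /c1_adj; lia.
Qed.

Lemma adjeq_np2_product (X Y : digital_image) (p q : np2_product X Y) :
  adjeq p.1 q.1 -> adjeq p.2 q.2 -> adjeq p q.
Proof. by move=> pq1 pq2; have [->|npq] := EM (p = q); [right|left]. Qed.

Lemma punctuated_homotopy_strong (X Y : digital_image) (f g : X -> Y) (k : nat)
    (H : X * interval0 k -> Y) :
  homotopy f g H -> punctuated H -> strong_homotopy f g H.
Proof.
move=> [H0 Hk Htime Hspace] Hp; split=> //.
have step (x x' : X) (s t : interval0 k) : adjeq x x' ->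
    (t : nat) = (s : nat).+1 -> adjeq (H (x, s)) (H (x', t)).
  move=> xx' ts.
  have sk : s < k by have := ltn_ord t; lia.
  have [xs] := Hp (Ordinal sk).
  rewrite (_ : widen_ord _ _ = s); last exact: val_inj.
  rewrite (_ : lift _ _ = t) => [Hxs|]; last by apply: val_inj; rewrite /= ts.
  (* If [x = x'], this is continuity in time. Otherwise one of the two points differs from [xs]: if
     it is [x], both values are compared at stage [t], else at stage [s]. *)
  have [->|nxx'] := EM (x = x').
    by apply: (digitally_continuous_adjeq (Htime x')); apply/adjeq_intervalP; lia.
  have [xE|nx] := EM (x = xs); last first.
    by rewrite Hxs //; exact: (digitally_continuous_adjeq (Hspace t)).
  rewrite -(Hxs x') => [|x'E]; last by apply: nxx'; rewrite xE x'E.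
  exact: (digitally_continuous_adjeq (Hspace s)).
move=> [x s] [x' t] [_ /= xx' /adjeq_intervalP st].
have [ts|[ts|ts]] : (t : nat) = s.+1 \/ (s : nat) = t.+1 \/ (s : nat) = t by lia.
- exact: step.
- by apply/adjeq_sym/step => //; exact/adjeq_sym.
- by rewrite (val_inj ts); exact: (digitally_continuous_adjeq (Hspace t)).
Qed.

Section Staggering.
Variables (X Y : digital_image) (n k : nat) (e : X -> nat).
Hypotheses (e_lt : forall x, e x < n) (e_inj : injective e).

(** [inord] returns [ord0] out of range; [stagger_time_bound] shows that this default never
    occurs. *)
Definition stagger (H : X * interval0 k -> Y) (p : X * interval0 (k * n)) : Y :=
  H (p.1, inord ((p.2 + e p.1) %/ n)).

Lemma stagger_time_bound x (t : interval0 (k * n)) : (t + e x) %/ n < k.+1.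
Proof. by rewrite ltn_divLR; have := e_lt x; have := ltn_ord t; lia. Qed.

Lemma stagger_homotopy (f g : X -> Y) (H : X * interval0 k -> Y) :
  strong_homotopy f g H -> homotopy f g (stagger H).
Proof.
move=> [H0 Hk Hcont].
have near x x' (s t : interval0 (k * n)) : adjeq x x' ->
    (s + e x) %/ n <= ((t + e x') %/ n).+1 ->
    (t + e x') %/ n <= ((s + e x) %/ n).+1 ->
    adjeq (stagger H (x, s)) (stagger H (x', t)).
  move=> xx' st ts; apply: (digitally_continuous_adjeq Hcont).
  apply: adjeq_np2_product => //; apply/adjeq_intervalP.
  by rewrite /= !inordK ?stagger_time_bound.
(* Covers both continuity checks: a time step changes the numerator by at most [1 <= n], and a
   change of point changes it by less than [n]. *)
have divn_near a b : 0 < n -> a <= b + n -> a %/ n <= (b %/ n).+1.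
  move=> n0 ab; apply: leq_trans (leq_div2r n ab) _.
  by rewrite divnDr // divnn n0 addn1.
split=> [x|x|x s t|t x x' xx'].
- rewrite -H0 /stagger /= add0n divn_small //; congr (H (_, _)).
  by apply: val_inj; rewrite /= inordK.
- have n0 : 0 < n by apply: leq_ltn_trans (e_lt x).
  rewrite -Hk /stagger /= divnMDl // divn_small // addn0; congr (H (_, _)).
  by apply: val_inj; rewrite /= inordK.
- move=> st; have /adjeq_intervalP[? ?] : adjeq s t by left.
  have ex := e_lt x.
  by apply: near; [right|apply: divn_near; lia..].
- have ex := e_lt x; have ex' := e_lt x'.
  by apply: near; [left|apply: divn_near; lia..].
Qed.

Lemma stagger_punctuated (x0 : X) (H : X * interval0 k -> Y) :
  punctuated (stagger H).
Proof.
move=> t.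
have stay x : ~~ (n %| (t + e x).+1) ->
    stagger H (x, widen_ord (leqnSn _) t) = stagger H (x, lift ord0 t).
  move=> ndiv; have n0 : 0 < n by apply: leq_ltn_trans (e_lt x).
  by rewrite /stagger /= /bump /= add1n addSn divnS // (negPf ndiv).
have [[xt xtP]|none] := EM (exists x, n %| (t + e x).+1); last first.
  (* Nothing moves at this stage, so any point can serve as the exceptional one. *)
  by exists x0 => x _; apply: stay; apply/negP => ?; apply: none; exists x.
exists xt => x nx; apply: stay; apply/negP => xP; apply: nx; apply: e_inj.
(* Both [t.+1 + e x] and [t.+1 + e xt] vanish modulo [n]; delays below [n] that are congruent are
   equal. *)
have : e x == e xt %[mod n].
  rewrite -(eqn_modDl t.+1) !addSn.
  by rewrite (eqP xP) (eqP xtP).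
by rewrite !modn_small // => /eqP.
Qed.

End Staggering.

Theorem corollary3p4 (X Y : digital_image) (f g : X -> Y)
  (Xfin : finite_set [set: X]) (Xne : [set: X] !=set0)
  (fcont : digitally_continuous f) (gcont : digitally_continuous g) :
  strongly_homotopic f g <-> punctuated_homotopic f g.
Proof.
split=> [[k k0 [H Hs]]|[k k0 [H [Hh Hp]]]]; last first.
  by exists k => //; exists H; exact: punctuated_homotopy_strong.
have [n [e [e_lt e_inj]]] := finite_type_bounded_injection Xfin.
have [x0 _] := Xne.
(* The bound [e x0 < n] forces [n] to be positive. *)
exists (k * n); first by rewrite muln_gt0 k0 (leq_ltn_trans _ (e_lt x0)).
exists (stagger (n := n) e H); split; first exact: stagger_homotopy.
exact: stagger_punctuated.
Qed.
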